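(* Let $k$ and $t$ be positive integers with $0<t<k-1$. Then the $\left(\binom{k}{t},k,t,\binom{k}{t+1}\right)$ PDA $\mathbf{P}_2$ is Pareto-optimal.
   Context: Write $[0,b)=\{0,1,\ldots,b-1\}$. For positive integers $K,F$, a $(K,F,S)$ placement delivery array (PDA) is an $F\times K$ array $\mathbf{P}=(p_{i,j})$, $i\in[0,F)$, $j\in[0,K)$, each of whose entries is either the symbol $*$ (''star'') or an integer from $[0,S)$, such that: whenever two distinct entries satisfy $p_{i_1,j_1}=p_{i_2,j_2}=s$ with $s$ an integer, then (a) $i_1\neq i_2$ and $j_1\neq j_2$, and (b) $p_{i_1,j_2}=p_{i_2,j_1}=*$. A $(K,F,Z,S)$ PDA (with $1\le Z\leq F$) is a $(K,F,S)$ PDA in which each column has exactly $Z$ stars. The rate of a $(K,F,Z,S)$ PDA is $R=S/F$, its packet number is $F$, and its memory ratio is $Z/F$. A $(K,F,Z,S)$ PDA is called Pareto-optimal if it achieves the tradeoff between $R$ and $F$ among PDAs with the same number of columns $K$ and the same memory ratio: for every $(K,F',Z',S')$ PDA with $Z'/F'=Z/F$, (i) if $F'<F$ then $S'/F'>S/F$, and (ii) if $S'/F'<S/F$ then $F'>F$. A PDA $\mathbf{P}_2$ with the stated parameters exists for all $0<t<k-1$; Pareto-optimality depends only on its parameters. *)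

(* Defs.v *)
From mathcomp Require Import all_boot all_order all_algebra.

Set Implicit Arguments.
Unset Strict Implicit.
Unset Printing Implicit Defensive.

Import Order.TTheory GRing.Theory Num.Theory.

(* [None] encodes a star.  As in (K, F, S), columns come first in the
   parameters, while the array itself has F rows and K columns. *)
Definition array (K F S : nat) := 'M[option 'I_S]_(F, K).

Definition is_PDA (K F S : nat) (P : array K F S) : Prop :=
  [/\ 0 < K, 0 < F &
      forall (i1 i2 : 'I_F) (j1 j2 : 'I_K) (s : 'I_S),
        (i1, j1) <> (i2, j2) -> P i1 j1 = Some s -> P i2 j2 = Some s ->
        (i1 <> i2 /\ j1 <> j2) /\ (P i1 j2 = None /\ P i2 j1 = None)].

Definition is_regular_PDA (K F Z S : nat) (P : array K F S) : Prop :=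
  [/\ 1 <= Z <= F, is_PDA P &
      forall j : 'I_K, #|[set i : 'I_F | P i j == None]| = Z].

Definition rate (F S : nat) : rat := (S%:R / F%:R)%R.

Definition memory_ratio (F Z : nat) : rat := (Z%:R / F%:R)%R.

Definition Pareto_optimal (K F Z S : nat) (P : array K F S) : Prop :=
  is_regular_PDA Z P /\
  forall (F' Z' S' : nat) (P' : array K F' S'),
    is_regular_PDA Z' P' -> memory_ratio F' Z' = memory_ratio F Z ->
    (F' < F -> (rate F S < rate F' S')%R) /\
    ((rate F' S' < rate F S)%R -> F < F').

(* Rows are the points of 'I_k, columns its t-subsets B, and the entry at
   (i, B) is a star if i belongs to B and (the index of) i |: B otherwise. *)
Lemma regular_PDA_subsets (k t : nat) :
  0 < t < k - 1 ->
  exists P : array 'C(k, t) k 'C(k, t.+1), is_regular_PDA t P.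
Proof.
move=> /andP[t0 tk]; have ltk : t < k by rewrite (leq_trans tk) ?leq_subr.
have cD m : #|[set A : {set 'I_k} | #|A| == m]| = 'C(k, m).
  by rewrite card_draws card_ord.
rewrite -!cD; set D := [set A : {set 'I_k} | #|A| == t].
set E := [set A : {set 'I_k} | #|A| == t.+1].
have cB (j : 'I_#|D|) : #|enum_val j| = t.
  by have := enum_valP j; rewrite inE => /eqP.
have inE' i (j : 'I_#|D|) : i \notin enum_val j -> i |: enum_val j \in E.
  by move=> h; rewrite inE cardsU1 h cB.
have E0 : 0 < #|E| by rewrite cD bin_gt0.
have [A0 A0E] : exists A, A \in E by apply/card_gt0P.
pose P : array #|D| k #|E| := (\matrix_(i < k, j < #|D|)
  if i \in enum_val j then None
  else Some (enum_rank_in A0E (i |: enum_val j)))%R.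
have PN (i : 'I_k) (j : 'I_#|D|) : (P i j == None) = (i \in enum_val j).
  by rewrite mxE; case: ifP.
exists P; split; first by rewrite t0 ltnW.
  split; [by rewrite cD bin_gt0 ltnW | exact: leq_trans ltk |].
  move=> i1 i2 j1 j2 s ne; rewrite !mxE.
  case: ifPn => // h1 [<-]; case: ifPn => // h2 [] /enum_rank_in_inj e.
  have {}e : i2 |: enum_val j2 = i1 |: enum_val j1 by apply: e; exact: inE'.
  have ni : i1 <> i2.
    move=> ei; apply: ne; congr pair => //; apply: enum_val_inj.
    by subst i2; rewrite -(setU1K h1) -(setU1K h2) e.
  have m12 : i1 \in enum_val j2.
    have := setU11 i1 (enum_val j1).
    by rewrite -e in_setU1 => /predU1P[/ni|].
  have m21 : i2 \in enum_val j1.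
    have := setU11 i2 (enum_val j2).
    by rewrite e in_setU1 => /predU1P[/esym/ni|].
  split; last by rewrite m12 m21.
  by split=> // ej; move: h1; rewrite ej m12.
by move=> j; rewrite -[RHS](cB j); apply: eq_card => i; rewrite inE PN.
Qed.

(* Main.v *)
Require Import Defs.
From mathcomp Require Import all_boot all_order all_algebra.
From mathcomp Require Import zify.

Set Implicit Arguments.
Unset Strict Implicit.
Unset Printing Implicit Defensive.

(** If the integer [s] occurs at [(i, j)], then its other occurrences lie in
    distinct rows, each of which has a star in column [j]; hence [s] occurs at
    most [Z + 1] times. Counting the [K (F - Z)] integer entries gives
    [K (F - Z) <= S (Z + 1)]. For fixed [K] and [Z / F] this bounds the rate
    below by [K (1 - Z / F) / (Z + 1)], which decreases with [Z], and [P2]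
    attains the bound. *)

Import GRing.Theory Num.Theory.

Lemma card_occurrences_le (K F Z S : nat) (P : array K F S) (s : 'I_S) :
  is_regular_PDA Z P ->
  #|[set p : 'I_F * 'I_K | P p.1 p.2 == Some s]| <= Z.+1.
Proof.
move=> [_ [_ _ hP] hZ]; set O := [set p | _].
have [->|[[i0 j0] O0]] := set_0Vmem O; first by rewrite cards0.
move: (O0); rewrite inE /= => /eqP e0.
(* Setting [(i0, j0)] aside accounts for the [+ 1]; [fst] will embed the other occurrences into the
   stars of column [j0]. *)
rewrite (cardsD1 (i0, j0)) O0 add1n ltnS -(hZ j0).
have inj : {in O :\ (i0, j0) &, injective fst}.
  move=> [i1 j1] [i2 j2]; rewrite !inE /=.
  move=> /andP[_ /eqP e1] /andP[_ /eqP e2] ei; apply/eqP/negP => /negP/eqP ne.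
  by have [[]] := hP _ _ _ _ _ ne e1 e2.
rewrite -(card_in_imset inj); apply/subset_leq_card/subsetP => i.
case/imsetP => -[i1 j1]; rewrite !inE /= => /andP[/eqP ne /eqP e1] ->.
by have [_ [->]] := hP _ _ _ _ _ ne e1 e0.
Qed.

Lemma card_integer_entries (K F Z S : nat) (P : array K F S) :
  is_regular_PDA Z P ->
  #|[set p : 'I_F * 'I_K | P p.1 p.2 != None]| = K * (F - Z).
Proof.
move=> [_ _ hZ]; rewrite -sum1dep_card.
rewrite -(pair_big_dep xpredT (fun i j => P i j != None) (fun _ _ => 1)) /=.
(* Regularity is a condition on columns, so the column sum has to be outermost. *)
rewrite (exchange_big_dep xpredT) //=.
rewrite (eq_bigr (fun=> F - Z)) ?sum_nat_const ?card_ord // => j _.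
rewrite sum1dep_card; set A := [set i | P i j == None].
have -> : #|[set i | P i j != None]| = #|~: A|.
  by apply: eq_card => i; rewrite !inE.
by have := cardsC A; rewrite (hZ j) card_ord; lia.
Qed.

Lemma regular_PDA_bound (K F Z S : nat) (P : array K F S) :
  is_regular_PDA Z P -> K * (F - Z) <= S * Z.+1.
Proof.
move=> hP; rewrite -(card_integer_entries hP).
apply: (@leq_trans (\sum_(s < S)
    #|[set p : 'I_F * 'I_K | P p.1 p.2 == Some s]|)); last first.
  rewrite -[X in _ <= X * _]card_ord -sum_nat_const.
  by apply: leq_sum => s _; exact: card_occurrences_le.
have -> : [set p : 'I_F * 'I_K | P p.1 p.2 != None] =
    \bigcup_(s < S) [set p : 'I_F * 'I_K | P p.1 p.2 == Some s].
  apply/setP => p; rewrite inE; apply/idP/bigcupP => [|[s _]].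
    by case e: (P p.1 p.2) => [s|] // _; exists s; rewrite ?inE ?e.
  by rewrite inE => /eqP->.
elim/big_rec2: _ => [|s m A _ IH]; first by rewrite cards0.
by rewrite (leq_trans (leq_card_setU _ _)) // leq_add2l.
Qed.

Lemma ltr_div_nat (a b c d : nat) : 0 < b -> 0 < d ->
  (a%:R / b%:R < c%:R / d%:R :> rat)%R = (a * d < c * b).
Proof.
move=> b0 d0; rewrite ltr_pdivrMr ?ltr0n // mulrAC ltr_pdivlMr ?ltr0n //.
by rewrite -!natrM ltr_nat.
Qed.

Theorem theorem10 (k t : nat) (htk : 0 < t < k - 1)
    (P2 : array 'C(k, t) k 'C(k, t.+1)) (hP2 : is_regular_PDA t P2) :
  Pareto_optimal t P2.
Proof.
split=> // F' Z' S' P' hP'.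
have [/andP[Z0 ZF] [K0 F0 _] _] := hP'.
have k0 : 0 < k by lia.
have F0r : (F'%:R != 0 :> rat)%R by rewrite pnatr_eq0 -lt0n.
have k0r : (k%:R != 0 :> rat)%R by rewrite pnatr_eq0 -lt0n.
move/eqP; rewrite /memory_ratio eqr_div // -!natrM eqr_nat => /eqP eZ.
rewrite /rate !ltr_div_nat //.
have := regular_PDA_bound hP'.
have := mul_bin_left k t; move: K0.
set K := 'C(k, t); set S := 'C(k, t.+1) => K0 eS hS.
(* [P2] attains the bound: [eS] says [t.+1 * S = K * (k - t)]. Multiplying by [F'] and using the
   equal memory ratios [eZ] brings in the left side of the bound [hS] for [P']. *)
have eB : t.+1 * (S * F') = k * (K * (F' - Z')).
  have : (k - t) * F' = k * (F' - Z').
    by rewrite mulnBl mulnBr (mulnC k Z') eZ.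
  by rewrite mulnA eS => e; rewrite mulnAC e; lia.
have ZF' : Z' < F' by nia.
have le1 : t.+1 * (S * F') <= k * (S' * Z'.+1) by rewrite eB leq_mul2l hS orbT.
(* Positivity of [S'] keeps the inequality strict when [Z'.+1 < t.+1] is multiplied by [S' * k] in
   part (i). *)
have S0 : 0 < S'.
  have : 0 < S' * Z'.+1 by rewrite (leq_trans _ hS) // muln_gt0 K0 subn_gt0.
  by rewrite muln_gt0 => /andP[].
split=> [ltF|lt1].
  (* At a fixed memory ratio, fewer rows mean fewer stars per column, so [Z'.+1 < t.+1] in [le1] and
     [t.+1] cancels. *)
  have ltZ : Z' < t by nia.
  rewrite -(ltn_pmul2l (ltn0Sn t)); apply: (leq_ltn_trans le1).
  by rewrite mulnA (mulnC k) mulnC ltn_pmul2r ?muln_gt0 ?S0.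
(* By contraposition: [F' <= k] gives [Z' <= t], and the same cancellation in weak form contradicts
   [lt1]. *)
rewrite ltnNge; apply/negP => leF.
have leZ : Z' <= t by nia.
have : t.+1 * (S * F') <= t.+1 * (S' * k).
  apply: (leq_trans le1).
  by rewrite mulnA (mulnC k) mulnC leq_mul2r ltnS leZ orbT.
by rewrite leq_pmul2l // leqNgt lt1.
Qed.
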